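(* Let $\hat v\in\mathbb{C}^{3N}$ be a solution to the load-flow equations with power injection $\hat s\in\mathbb{C}^{6N}$, and suppose that $\xi(\hat s)<(\gamma(\hat v))^2$. Let $s\in\mathbb{C}^{6N}$ be a vector of power injections satisfying $$\xi(s-\hat s)<\frac14\left(\frac{(\gamma(\hat v))^2-\xi(\hat s)}{\gamma(\hat v)}\right)^2 .$$ Let $$\rho^\ddagger:=\frac12\left(\frac{(\gamma(\hat v))^2-\xi(\hat s)}{\gamma(\hat v)}\right),\qquad \rho^\dagger:=\rho^\ddagger-\sqrt{(\rho^\ddagger)^2-\xi(s-\hat s)} ,$$ and let $v\in\mathcal{D}_{\rho^\dagger}(\hat v)$ be the corresponding (unique) solution to the load-flow equations with power injection $s$, where $\mathcal{D}_\rho(\hat v)=\{v\in\mathbb{C}^{3N}:\ |(v)_j-(\hat v)_j|\le\rho\,|(w)_j|,\ j=1,\dots,3N\}$. Let $$\tilde v:=w+Y_{LL}^{-1}\left(\mathrm{diag}(\overline{\hat v})^{-1}\,\overline{s^Y}+H^{\mathsf T}\,\mathrm{diag}(H\overline{\hat v})^{-1}\,\overline{s^\Delta}\right).$$ Then $$\|\tilde v-v\|_\infty\le q\,\rho^\dagger\,\|w\|_\infty,\qquad\text{where}\qquad q:=\frac{\xi^Y(s)}{(\alpha(\hat v)-\rho^\dagger)^2}+\frac{\xi^\Delta(s)}{(\beta(\hat v)-\rho^\dagger)^2}<1 .$$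
   Context: Network data. Let $N\ge 1$ be an integer (number of three-phase $PQ$ buses). Let $Y_{L0}\in\mathbb{C}^{3N\times 3}$ and $Y_{LL}\in\mathbb{C}^{3N\times 3N}$ be the blocks of the three-phase admittance matrix $Y=\begin{pmatrix}Y_{00}&Y_{0L}\\ Y_{L0}&Y_{LL}\end{pmatrix}\in\mathbb{C}^{3(N+1)\times 3(N+1)}$, and let $v_0\in\mathbb{C}^3$ be the (fixed, known) slack-bus voltage vector. It is assumed that $Y_{LL}$ is invertible. Put $w:=-Y_{LL}^{-1}Y_{L0}v_0\in\mathbb{C}^{3N}$ (zero-load voltage); all entries of $w$ are assumed nonzero. Put $W:=\mathrm{diag}(w)$. Let $H\in\mathbb{R}^{3N\times 3N}$ be the block-diagonal matrix with $N$ diagonal blocks all equal to $$\Gamma=\begin{pmatrix}1&-1&0\\0&1&-1\\-1&0&1\end{pmatrix},$$ and let $L:=|H|$ be its entrywise absolute value. Conventions. $|\cdot|$ of a vector or matrix is entrywise; $\overline{\,\cdot\,}$ is (entrywise) complex conjugation; $^{\mathsf T}$ is transposition; $\mathrm{diag}(x)$ is the diagonal matrix with diagonal $x$; $\|x\|_\infty=\max_j|(x)_j|$ for a vector $x$ and $\|A\|_\infty=\max_i\sum_j|A_{ij}|$ for a complex matrix $A$; $(x)_j$ is the $j$-th entry of $x$. A vector of power injections is $s=((s^Y)^{\mathsf T},(s^\Delta)^{\mathsf T})^{\mathsf T}\in\mathbb{C}^{6N}$ with $s^Y,s^\Delta\in\mathbb{C}^{3N}$. Load-flow equations. A vector $v\in\mathbb{C}^{3N}$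 is a solution to the load-flow equations with power injection $s$ if there are $i,i^\Delta\in\mathbb{C}^{3N}$ such that $$\mathrm{diag}(H^{\mathsf T}\overline{i^\Delta})\,v+s^Y=\mathrm{diag}(v)\,\overline{i},\qquad s^\Delta=\mathrm{diag}(Hv)\,\overline{i^\Delta},\qquad i=Y_{L0}v_0+Y_{LL}v .$$ When all entries of $v$ and of $Hv$ are nonzero this is written as the fixed-point equation $$v=w+Y_{LL}^{-1}\left(\mathrm{diag}(\overline v)^{-1}\,\overline{s^Y}+H^{\mathsf T}\,\mathrm{diag}(H\overline v)^{-1}\,\overline{s^\Delta}\right).$$ Quantities. For $s\in\mathbb{C}^{6N}$: $$\xi^Y(s):=\|W^{-1}Y_{LL}^{-1}W^{-1}\mathrm{diag}(s^Y)\|_\infty,\qquad \xi^\Delta(s):=\|W^{-1}Y_{LL}^{-1}H^{\mathsf T}\mathrm{diag}(L|w|)^{-1}\mathrm{diag}(s^\Delta)\|_\infty,\qquad \xi(s):=\xi^Y(s)+\xi^\Delta(s).$$ For $v\in\mathbb{C}^{3N}$: $$\alpha(v):=\min_j\frac{|(v)_j|}{|(w)_j|},\qquad \beta(v):=\min_j\frac{|(Hv)_j|}{(L|w|)_j},\qquad \gamma(v):=\min\{\alpha(v),\beta(v)\},$$ with $j$ ranging over $1,\dots,3N$. Under the stated hypotheses on $\hat v,\hat s,s$, the paper shows that the load-flow equations with power injection $s$ have a unique solution in $\mathcal{D}_{\rho^\ddagger}(\hat v)$ and that this solution lies in $\mathcal{D}_{\rho^\dagger}(\hat v)$; this is the $v$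 of the statement. The vector $\tilde v$ is the fixed-point linearization (FPL) approximation of $v$. *)

(* Defs.v *)
(* The real numbers are an arbitrary R : realType and the complex numbers are
   R[i]. *)
From mathcomp Require Import all_boot all_order all_algebra.
From mathcomp Require Import reals.
From mathcomp Require Export complex.

Set Implicit Arguments.
Unset Strict Implicit.
Unset Printing Implicit Defensive.

Import Order.TTheory GRing.Theory Num.Theory.

Local Open Scope ring_scope.
Local Open Scope complex_scope.

Section Conventions.
Context {R : realType}.

(* Real-valued modulus; the generic norm on R[i] takes its values in R[i]. *)
Definition cabs (z : R[i]) : R := ComplexField.Normc.normc z.

Definition absv {m n} (A : 'M[R[i]]_(m, n)) : 'M[R]_(m, n) := map_mx cabs A.

Definition conjv {m n} (A : 'M[R[i]]_(m, n)) : 'M[R[i]]_(m, n) :=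
  map_mx (@conjc R) A.

Definition toC {m n} (A : 'M[R]_(m, n)) : 'M[R[i]]_(m, n) :=
  map_mx (real_complex R) A.

Definition diag {n} (x : 'cV[R[i]]_n) : 'M[R[i]]_n := diag_mx x^T.

Definition vnorm_inf {n} (x : 'cV[R[i]]_n) : R :=
  \big[Num.max/0]_j cabs (x j 0).

Definition mnorm_inf {m n} (A : 'M[R[i]]_(m, n)) : R :=
  \big[Num.max/0]_i \sum_j cabs (A i j).

(* The initial value is itself a value of f as soon as 0 < n, so that it does
   not affect the minimum; the result is 0 when n = 0. *)
Definition vmin {n} (f : 'I_n -> R) : R :=
  \big[Num.min/head 0 (codom f)]_j f j.

End Conventions.

Section Network.
Context {R : realType} {N : nat}.

Definition Gamma : 'M[R]_3 :=
  \matrix_(i, j) nth 0 (nth [::] [:: [:: 1; -1; 0];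
                                     [:: 0; 1; -1];
                                     [:: -1; 0; 1]] i) j.

Definition Hmat : 'M[R]_(3 * N) :=
  \matrix_(i, j) if (i %/ 3 == j %/ 3)%N
                 then Gamma (inord (i %% 3)) (inord (j %% 3)) else 0.

Definition Lmat : 'M[R]_(3 * N) := map_mx Num.norm Hmat.

Definition HC : 'M[R[i]]_(3 * N) := toC Hmat.

(* The first three indices of the admittance matrix Y are the slack bus. *)
Variables (Y : 'M[R[i]]_(3 + 3 * N)) (v0 : 'cV[R[i]]_3).

Definition YL0 : 'M[R[i]]_(3 * N, 3) := dlsubmx Y.
Definition YLL : 'M[R[i]]_(3 * N) := drsubmx Y.

Definition zero_load : 'cV[R[i]]_(3 * N) := - (invmx YLL *m YL0 *m v0).

Let w := zero_load.

(* L|w| *)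
Definition Labsw : 'cV[R]_(3 * N) := Lmat *m absv w.

Definition wye (s : 'cV[R[i]]_(3 * N + 3 * N)) : 'cV[R[i]]_(3 * N) :=
  usubmx s.
Definition delta (s : 'cV[R[i]]_(3 * N + 3 * N)) : 'cV[R[i]]_(3 * N) :=
  dsubmx s.

Definition load_flow (s : 'cV[R[i]]_(3 * N + 3 * N))
    (v : 'cV[R[i]]_(3 * N)) : Prop :=
  exists i iD : 'cV[R[i]]_(3 * N),
    [/\ diag (HC^T *m conjv iD) *m v + wye s = diag v *m conjv i,
        delta s = diag (HC *m v) *m conjv iD
      & i = YL0 *m v0 + YLL *m v].

Definition xiY (s : 'cV[R[i]]_(3 * N + 3 * N)) : R :=
  mnorm_inf (invmx (diag w) *m invmx YLL *m invmx (diag w) *m diag (wye s)).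

Definition xiD (s : 'cV[R[i]]_(3 * N + 3 * N)) : R :=
  mnorm_inf (invmx (diag w) *m invmx YLL *m HC^T
             *m invmx (diag (toC Labsw)) *m diag (delta s)).

Definition xi (s : 'cV[R[i]]_(3 * N + 3 * N)) : R := xiY s + xiD s.

Definition alpha (v : 'cV[R[i]]_(3 * N)) : R :=
  vmin (fun j => cabs (v j 0) / cabs (w j 0)).

Definition beta (v : 'cV[R[i]]_(3 * N)) : R :=
  vmin (fun j => cabs ((HC *m v) j 0) / Labsw j 0).

Definition gamma (v : 'cV[R[i]]_(3 * N)) : R := Num.min (alpha v) (beta v).

Definition in_D (rho : R) (vhat v : 'cV[R[i]]_(3 * N)) : Prop :=
  forall j, cabs (v j 0 - vhat j 0) <= rho * cabs (w j 0).

Definition rho_ddagger (vhat : 'cV[R[i]]_(3 * N))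
    (shat : 'cV[R[i]]_(3 * N + 3 * N)) : R :=
  2^-1 * ((gamma vhat ^+ 2 - xi shat) / gamma vhat).

Definition rho_dagger (vhat : 'cV[R[i]]_(3 * N))
    (shat s : 'cV[R[i]]_(3 * N + 3 * N)) : R :=
  rho_ddagger vhat shat
  - Num.sqrt (rho_ddagger vhat shat ^+ 2 - xi (s - shat)).

Definition fpl (vhat : 'cV[R[i]]_(3 * N))
    (s : 'cV[R[i]]_(3 * N + 3 * N)) : 'cV[R[i]]_(3 * N) :=
  w + invmx YLL *m (invmx (diag (conjv vhat)) *m conjv (wye s)
        + HC^T *m invmx (diag (HC *m conjv vhat)) *m conjv (delta s)).

Definition fpl_rate (vhat : 'cV[R[i]]_(3 * N))
    (shat s : 'cV[R[i]]_(3 * N + 3 * N)) : R :=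
  xiY s / (alpha vhat - rho_dagger vhat shat s) ^+ 2
  + xiD s / (beta vhat - rho_dagger vhat shat s) ^+ 2.

End Network.

(* Main.v *)
(* A solution v with nonzero entries of v and Hv is a fixed point of the
   load-flow map, whose form is [fpl Y v0 v s], so the error is the difference
   of that map at vhat and at v.  On the disc of radius r around vhat the
   reciprocals of the entries of v and Hv differ from those at vhat by at most
   r / (a - r)^2 in units of 1 / |w| and 1 / (L|w|), with a = alpha and
   a = beta respectively, and weighting by W turns this into the rate q.
   Finally (gamma - rho_ddagger)^2 = xi(shat) + rho_ddagger^2, which exceeds
   xi(s), while q <= xi(s) / (gamma - rho_dagger)^2; hence q < 1. *)
Require Import Defs.
From mathcomp Require Import all_boot all_order all_algebra.
From mathcomp Require Import reals.
From mathcomp Require Import ring lra.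

Set Implicit Arguments.
Unset Strict Implicit.
Unset Printing Implicit Defensive.

Import Order.TTheory GRing.Theory Num.Theory.

Local Open Scope ring_scope.
Local Open Scope complex_scope.

(** * Modulus of complex numbers and perturbation of reciprocals *)

Section Modulus.
Context {R : realType}.
Implicit Types (x y z : R[i]).

Lemma cabs_ge0 z : 0 <= cabs z.
Proof. by case: z => a b; apply: sqrtr_ge0. Qed.

Lemma cabs0 : cabs (0 : R[i]) = 0.
Proof. exact: ComplexField.Normc.normc0. Qed.

Lemma cabs_eq0 z : (cabs z == 0) = (z == 0).
Proof.
apply/eqP/eqP => [|->]; last exact: cabs0.
exact: ComplexField.Normc.eq0_normc.
Qed.

Lemma cabs_gt0 z : (0 < cabs z) = (z != 0).
Proof. by rewrite lt_def cabs_ge0 andbT cabs_eq0. Qed.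

Lemma cabsM x y : cabs (x * y) = cabs x * cabs y.
Proof. exact: ComplexField.Normc.normcM. Qed.

Lemma cabsV x : cabs x^-1 = (cabs x)^-1.
Proof. exact: ComplexField.Normc.normcV. Qed.

Lemma cabsD x y : cabs (x + y) <= cabs x + cabs y.
Proof. exact: le_normcD. Qed.

Lemma cabsN x : cabs (- x) = cabs x.
Proof. exact: normcN. Qed.

Lemma cabs_conj x : cabs x^*%C = cabs x.
Proof. by case: x => a b; rewrite /cabs /= sqrrN. Qed.

Lemma cabs_real (a : R) : cabs a%:C = `|a|.
Proof. by rewrite /cabs /= expr0n /= addr0 sqrtr_sqr. Qed.

Lemma cabs_sum I (r : seq I) (P : pred I) (F : I -> R[i]) :
  cabs (\sum_(i <- r | P i) F i) <= \sum_(i <- r | P i) cabs (F i).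
Proof.
elim/big_ind2 : _ => [|x a y b xa yb|//]; first by rewrite cabs0.
exact: le_trans (cabsD _ _) (lerD xa yb).
Qed.

Lemma cabsB_ge x y : cabs x - cabs (x - y) <= cabs y.
Proof.
rewrite lerBlDr; apply: le_trans (cabsD y (x - y)).
by rewrite addrCA subrr addr0.
Qed.

(** In later uses [d] is the weight [|w|] or [L|w|] at one index, [a] is [alpha] or [beta], and [r]
    is the radius of a disc around [x] in units of [d]. *)
Lemma cabs_near_ge x y (a r d : R) :
  a * d <= cabs x -> cabs (y - x) <= r * d -> (a - r) * d <= cabs y.
Proof.
move=> ax yx; apply: le_trans (cabsB_ge x y).
rewrite -(cabsN (x - y)) opprB; lra.
Qed.

Lemma cabs_near_neq0 x y (a r d : R) : r < a -> 0 < d ->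
  a * d <= cabs x -> cabs (y - x) <= r * d -> y != 0.
Proof.
move=> ra d0 ax yx; rewrite -cabs_gt0 (lt_le_trans _ (cabs_near_ge ax yx))//.
by rewrite mulr_gt0 ?subr_gt0.
Qed.

(** The difference equals [(y - x) / (x * y)], and both factors of the denominator have modulus at
    least [(a - r) * d]. For [x] this weakens the bound [a * d], so as to obtain a square. *)
Lemma cabs_invB_le x y (a r d : R) : 0 <= r -> r < a -> 0 < d ->
  a * d <= cabs x -> cabs (y - x) <= r * d ->
  cabs (x^-1 - y^-1) <= r / (a - r) ^+ 2 / d.
Proof.
move=> r0 ra d0 ax yx.
have ard : 0 < (a - r) * d by rewrite mulr_gt0 ?subr_gt0.
have ay := cabs_near_ge ax yx.
have ax' : (a - r) * d <= cabs x.
  by apply: le_trans ax; rewrite ler_wpM2r ?(ltW d0)// lerBlDr lerDl.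
have x0 : x != 0 by rewrite -cabs_gt0 (lt_le_trans ard).
have y0 := cabs_near_neq0 ra d0 ax yx.
have -> : x^-1 - y^-1 = (y - x) / (x * y) by field; rewrite x0 y0.
have -> : r / (a - r) ^+ 2 / d = r * d / (((a - r) * d) * ((a - r) * d)).
  by field; rewrite (gt_eqF d0) gt_eqF ?subr_gt0.
rewrite cabsM cabsV cabsM ler_pM ?cabs_ge0 ?invr_ge0 ?mulr_ge0 ?cabs_ge0//.
rewrite lef_pV2 ?posrE; first by rewrite ler_pM// ltW.
  by rewrite mulr_gt0 ?cabs_gt0.
exact: mulr_gt0.
Qed.

End Modulus.

(** * Minima, maximum norms and diagonal matrices *)

Section Norms.
Context {R : realType}.

Lemma vmin_le n (f : 'I_n -> R) j : vmin f <= f j.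
Proof. exact: bigmin_le. Qed.

Lemma vmin_ge0 n (f : 'I_n -> R) : (forall j, 0 <= f j) -> 0 <= vmin f.
Proof.
move=> f0; apply: le_bigmin => //.
(* The initial value of the minimum is either a value of [f] or, for an empty index set, 0. *)
have : all (fun a => 0 <= a) (codom f) by apply/allP => _ /codomP[j ->].
by case: (codom f) => //= a l /andP[].
Qed.

Lemma vnorm_inf_ge n (x : 'cV[R[i]]_n) j : cabs (x j 0) <= vnorm_inf x.
Proof. exact: (le_bigmax _ (fun j => cabs (x j 0))). Qed.

Lemma vnorm_inf_ge0 n (x : 'cV[R[i]]_n) : 0 <= vnorm_inf x.
Proof. exact: bigmax_ge_id. Qed.

Lemma mnorm_inf_ge m n (A : 'M[R[i]]_(m, n)) i :
  \sum_j cabs (A i j) <= mnorm_inf A.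
Proof. exact: (le_bigmax _ (fun i => \sum_j cabs (A i j))). Qed.

Lemma mnorm_inf_ge0 m n (A : 'M[R[i]]_(m, n)) : 0 <= mnorm_inf A.
Proof. exact: bigmax_ge_id. Qed.

Lemma mnorm_infD m n (A B : 'M[R[i]]_(m, n)) :
  mnorm_inf (A + B) <= mnorm_inf A + mnorm_inf B.
Proof.
apply: bigmax_le => [|i _]; first by rewrite addr_ge0 ?mnorm_inf_ge0.
apply: le_trans (lerD (mnorm_inf_ge A i) (mnorm_inf_ge B i)).
by rewrite -big_split /=; apply: ler_sum => j _; rewrite mxE cabsD.
Qed.

Lemma diagD n (x y : 'cV[R[i]]_n) : diag (x + y) = diag x + diag y.
Proof. by rewrite /diag !raddfD. Qed.

Lemma mul_diag_col n (x y : 'cV[R[i]]_n) j :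
  (diag x *m y) j 0 = x j 0 * y j 0.
Proof. by rewrite /diag mul_diag_mx !mxE. Qed.

Lemma invmx_diag n (x : 'cV[R[i]]_n) : (forall j, x j 0 != 0) ->
  invmx (diag x) = diag (map_mx GRing.inv x).
Proof.
move=> x0.
have xV : diag x *m diag (map_mx GRing.inv x) = 1%:M.
  apply/matrixP => i j; rewrite /diag mul_diag_mx !mxE.
  by case: eqP => [->|_]; rewrite ?mulr0n ?mulr0// mulr1n divff.
have [xu _] := mulmx1_unit xV.
by rewrite -[RHS](mulKmx xu) xV mulmx1.
Qed.

Lemma invmx_diag_col n (x y : 'cV[R[i]]_n) j : (forall k, x k 0 != 0) ->
  (invmx (diag x) *m y) j 0 = (x j 0)^-1 * y j 0.
Proof. by move=> x0; rewrite invmx_diag// mul_diag_col mxE. Qed.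

(** Entry [(i, j)] of the weighted matrix has modulus [|M i j| * |t j| / (|u i| * |d j|)]. The
    weight [d] is the one in the bound on [x], and dividing by [u] is compensated by the last
    factor. With [u = w] this serves both [xiY] and [xiD]. *)
Lemma weighted_mulmx_le m n (M : 'M[R[i]]_(m, n)) (u : 'cV[R[i]]_m)
    (d t x : 'cV[R[i]]_n) (c : R) i :
  (forall k, u k 0 != 0) -> (forall k, d k 0 != 0) -> 0 <= c ->
  (forall j, cabs (x j 0) <= c / cabs (d j 0) * cabs (t j 0)) ->
  cabs ((M *m x) i 0)
    <= c * mnorm_inf (invmx (diag u) *m M *m invmx (diag d) *m diag t)
       * cabs (u i 0).
Proof.
move=> u0 d0 c0 xb; set A := invmx _ *m _ *m _ *m _.
have AE j : cabs (A i j)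
    = (cabs (u i 0))^-1 * cabs (M i j) * (cabs (d j 0))^-1 * cabs (t j 0).
  rewrite /A !invmx_diag// /diag mul_mx_diag mxE mul_mx_diag mxE.
  by rewrite mul_diag_mx !mxE !cabsM !cabsV.
have ui : 0 < cabs (u i 0) by rewrite cabs_gt0.
rewrite -ler_pdivrMr// mxE; apply: le_trans (ler_wpM2l c0 (mnorm_inf_ge A i)).
rewrite ler_pdivrMr//; apply: le_trans (cabs_sum _ _ _) _.
rewrite mulr_sumr mulr_suml; apply: ler_sum => j _.
rewrite AE cabsM; apply: le_trans (ler_wpM2l (cabs_ge0 _) (xb j)) _.
by rewrite le_eqVlt; apply/orP; left; apply/eqP; field; rewrite !gt_eqF ?cabs_gt0.
Qed.

End Norms.

(** * Load-flow quantities and the fixed-point map *)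

Section LoadFlow.
Context {R : realType} {N : nat}.
Variables (Y : 'M[R[i]]_(3 + 3 * N)) (v0 : 'cV[R[i]]_3).
Implicit Types (v x : 'cV[R[i]]_(3 * N)) (s t : 'cV[R[i]]_(3 * N + 3 * N)).
Local Notation w := (zero_load Y v0).
Local Notation HC := (HC : 'M[R[i]]_(3 * N)).

Lemma xiY_ge0 s : 0 <= xiY Y v0 s.
Proof. exact: mnorm_inf_ge0. Qed.

Lemma xiD_ge0 s : 0 <= xiD Y v0 s.
Proof. exact: mnorm_inf_ge0. Qed.

Lemma xi_ge0 s : 0 <= xi Y v0 s.
Proof. exact: addr_ge0 (xiY_ge0 s) (xiD_ge0 s). Qed.

Lemma xiY_addr s t : xiY Y v0 (s + t) <= xiY Y v0 s + xiY Y v0 t.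
Proof. by rewrite /xiY /wye raddfD diagD mulmxDr; apply: mnorm_infD. Qed.

Lemma xiD_addr s t : xiD Y v0 (s + t) <= xiD Y v0 s + xiD Y v0 t.
Proof. by rewrite /xiD /delta raddfD diagD mulmxDr; apply: mnorm_infD. Qed.

Lemma xi_addr s t : xi Y v0 (s + t) <= xi Y v0 s + xi Y v0 t.
Proof.
by rewrite /xi addrACA; apply: lerD; [exact: xiY_addr | exact: xiD_addr].
Qed.

Lemma Labsw_ge0 j : 0 <= Labsw Y v0 j 0.
Proof.
by rewrite mxE sumr_ge0// => k _; rewrite !mxE mulr_ge0 ?cabs_ge0.
Qed.

Lemma alpha_ge0 v : 0 <= alpha Y v0 v.
Proof. by apply: vmin_ge0 => j; rewrite divr_ge0 ?cabs_ge0. Qed.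

Lemma beta_ge0 v : 0 <= beta Y v0 v.
Proof. by apply: vmin_ge0 => j; rewrite divr_ge0 ?cabs_ge0 ?Labsw_ge0. Qed.

Lemma gamma_ge0 v : 0 <= gamma Y v0 v.
Proof. by rewrite le_min alpha_ge0 beta_ge0. Qed.

(* The quotient defining beta would be 0 where L|w| vanishes. *)
Lemma Labsw_gt0 v j : 0 < beta Y v0 v -> 0 < Labsw Y v0 j 0.
Proof.
move=> b0; rewrite lt_def Labsw_ge0 andbT; apply: contraTneq b0 => Lj.
rewrite -leNgt; apply: le_trans (vmin_le _ j) _.
by rewrite Lj invr0 mulr0.
Qed.

Lemma alpha_le v j : w j 0 != 0 -> alpha Y v0 v * cabs (w j 0) <= cabs (v j 0).
Proof. by move=> wj; rewrite -ler_pdivlMr ?cabs_gt0// vmin_le. Qed.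

Lemma beta_le v j : 0 < Labsw Y v0 j 0 ->
  beta Y v0 v * Labsw Y v0 j 0 <= cabs ((HC *m v) j 0).
Proof. by move=> Lj; rewrite -ler_pdivlMr// vmin_le. Qed.

(** Triangle inequality on row [j], where [|H|] is [L] entrywise; this makes [L|w|] the natural
    scale for [H v]. *)
Lemma HC_bound x (r : R) j : (forall k, cabs (x k 0) <= r * cabs (w k 0)) ->
  cabs ((HC *m x) j 0) <= r * Labsw Y v0 j 0.
Proof.
move=> xr; rewrite !mxE; apply: le_trans (cabs_sum _ _ _) _.
rewrite mulr_sumr; apply: ler_sum => k _.
rewrite cabsM mxE cabs_real [in leRHS]mxE [X in _ * (_ * X)]mxE mulrCA.
by rewrite ler_wpM2l.
Qed.

Lemma toC_conjv m n (A : 'M[R]_(m, n)) (x : 'cV[R[i]]_n) :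
  toC A *m conjv x = conjv (toC A *m x).
Proof.
rewrite /conjv map_mxM; congr (_ *m _).
by apply/matrixP => i j; rewrite !mxE; apply/esym/conjc_real.
Qed.

(** The equations are solved in turn: the delta one for [iD], the wye one for [i], and the network
    one for [v] by inverting [YLL]. *)
Lemma load_flow_fixed_point s v : YLL Y \in unitmx ->
  (forall j, v j 0 != 0) -> (forall j, (HC *m v) j 0 != 0) ->
  load_flow Y v0 s v -> v = fpl Y v0 v s.
Proof.
move=> Yu vn0 Hn0 [i [iD [eY eD ei]]].
have iDE : iD = invmx (diag (HC *m conjv v)) *m conjv (delta s).
  apply/colP => k; rewrite toC_conjv invmx_diag_col; last first.
    by move=> l; rewrite mxE conjc_eq0.
  rewrite eD [conjv (diag _ *m _) k 0]mxE mul_diag_col rmorphM /=.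
  by rewrite ![conjv _ k 0]mxE conjcK mulKf// conjc_eq0.
have iE : i = invmx (diag (conjv v)) *m conjv (wye s) + HC^T *m iD.
  have HT : HC^T = toC (Hmat : 'M[R]_(3 * N))^T by rewrite /toC map_trmx.
  apply/colP => k; rewrite mxE invmx_diag_col; last first.
    by move=> l; rewrite mxE conjc_eq0.
  (* Conjugating entry [k] of the wye equation leaves a linear equation for [i k 0], whose
     coefficient, the conjugate of [v k 0], is nonzero. *)
  have /colP/(_ k) := eY; rewrite mxE !mul_diag_col HT toC_conjv.
  rewrite ![conjv _ k 0]mxE => /(congr1 (@conjc R)).
  rewrite rmorphD !rmorphM /= !conjcK => /(canRL (addKr _)) ->.
  have : (v k 0)^*%C != 0 by rewrite conjc_eq0.
  by move: (v k 0)^*%C => c c0; field.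
rewrite /fpl -mulmxA -iDE -iE ei mulmxDr mulKmx// /zero_load -mulmxA.
by rewrite addrA addNr add0r.
Qed.

Lemma alpha_in_D x v (r : R) : 0 <= r -> r < alpha Y v0 x ->
  (forall j, w j 0 != 0) -> in_D Y v0 r x v ->
  forall j, [/\ x j 0 != 0, v j 0 != 0 &
    cabs ((x j 0)^-1 - (v j 0)^-1)
      <= r / (alpha Y v0 x - r) ^+ 2 / cabs (w j 0)].
Proof.
move=> r0 ra w0 xv j; have ax := alpha_le x (w0 j).
have wj : 0 < cabs (w j 0) by rewrite cabs_gt0.
split; last by apply: cabs_invB_le.
(* The centre [x] itself is the case of radius 0. *)
- apply: (cabs_near_neq0 (le_lt_trans r0 ra) wj ax).
  by rewrite subrr cabs0 mul0r.
- exact: cabs_near_neq0 ra wj ax (xv j).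
Qed.

(** By [HC_bound], [H] carries the disc around [x] into one around [H x] with weights [L|w|]; a
    positive [beta] makes these weights positive. *)
Lemma beta_in_D x v (r : R) : 0 <= r -> r < beta Y v0 x ->
  in_D Y v0 r x v ->
  forall j, [/\ (HC *m x) j 0 != 0, (HC *m v) j 0 != 0 &
    cabs (((HC *m x) j 0)^-1 - ((HC *m v) j 0)^-1)
      <= r / (beta Y v0 x - r) ^+ 2 / Labsw Y v0 j 0].
Proof.
move=> r0 rb xv j; have b0 := le_lt_trans r0 rb.
have Lj := Labsw_gt0 j b0; have bx := beta_le x Lj.
have Hxv : cabs ((HC *m v) j 0 - (HC *m x) j 0) <= r * Labsw Y v0 j 0.
  have -> : (HC *m v) j 0 - (HC *m x) j 0 = (HC *m (v - x)) j 0.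
    by rewrite mulmxBr [in RHS]mxE [X in _ = _ + X]mxE.
  by apply: HC_bound => k; rewrite [(v - x) k 0]mxE [(- x) k 0]mxE; apply: xv.
split; last by apply: cabs_invB_le.
- by apply: (cabs_near_neq0 b0 Lj bx); rewrite subrr cabs0 mul0r.
- exact: cabs_near_neq0 rb Lj bx Hxv.
Qed.

Lemma fpl_dist_le s x v (r : R) : (forall j, w j 0 != 0) ->
  0 <= r -> r < gamma Y v0 x -> in_D Y v0 r x v ->
  vnorm_inf (fpl Y v0 x s - fpl Y v0 v s)
    <= (xiY Y v0 s / (alpha Y v0 x - r) ^+ 2
        + xiD Y v0 s / (beta Y v0 x - r) ^+ 2) * r * vnorm_inf w.
Proof.
move=> w0 r0; rewrite lt_min => /andP[ra rb] xv.
have aD := alpha_in_D r0 ra w0 xv; have bD := beta_in_D r0 rb xv.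
have L0 j : 0 < Labsw Y v0 j 0 := Labsw_gt0 j (le_lt_trans r0 rb).
have q0 : 0 <= xiY Y v0 s / (alpha Y v0 x - r) ^+ 2
               + xiD Y v0 s / (beta Y v0 x - r) ^+ 2.
  by apply: addr_ge0; apply: divr_ge0;
    [exact: xiY_ge0 | exact: sqr_ge0 | exact: xiD_ge0 | exact: sqr_ge0].
(* Both the wye and the delta part of the error have this shape: [y] and [z] are voltages in the
   first, their images under [H] in the second. *)
pose inv_diff (y z p : 'cV[R[i]]_(3 * N)) : 'cV[R[i]]_(3 * N) :=
  invmx (diag (conjv y)) *m p - invmx (diag (conjv z)) *m p.
have inv_diffE (y z p : 'cV[R[i]]_(3 * N)) j : (forall k, y k 0 != 0) -> (forall k, z k 0 != 0) ->
    cabs (inv_diff y z (conjv p) j 0)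
      = cabs ((y j 0)^-1 - (z j 0)^-1) * cabs (p j 0).
  move=> y0 z0; rewrite mxE [X in _ + X]mxE !invmx_diag_col; last first.
  - by move=> k; rewrite mxE conjc_eq0.
  - by move=> k; rewrite mxE conjc_eq0.
  rewrite -mulrBl cabsM ![conjv _ j 0]mxE -!conjc_inv -rmorphB /=.
  by rewrite !cabs_conj.
have -> : fpl Y v0 x s - fpl Y v0 v s
    = invmx (YLL Y) *m inv_diff x v (conjv (wye s))
      + (invmx (YLL Y) *m HC^T)
        *m inv_diff (HC *m x) (HC *m v) (conjv (delta s)).
  rewrite /fpl !toC_conjv opprD addrACA subrr add0r -mulmxBr.
  by rewrite opprD addrACA -!mulmxA -!mulmxBr -mulmxDr.
apply: bigmax_le => [|j _]; first by rewrite !mulr_ge0 ?vnorm_inf_ge0.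
(* Each entry is bounded with its own weight [|w|] before passing to the maximum. *)
apply: le_trans (_ : _ <= (xiY Y v0 s / (alpha Y v0 x - r) ^+ 2
    + xiD Y v0 s / (beta Y v0 x - r) ^+ 2) * r * cabs (w j 0)) _; last first.
  by rewrite ler_wpM2l ?vnorm_inf_ge ?mulr_ge0.
have -> : forall p q a b : R, (p / a + q / b) * r * cabs (w j 0)
    = (r / a) * p * cabs (w j 0) + (r / b) * q * cabs (w j 0).
  by move=> p q a b; ring.
rewrite mxE; apply: le_trans (cabsD _ _) (lerD _ _).
- apply: weighted_mulmx_le => // [|k]; first by rewrite divr_ge0 ?sqr_ge0.
  rewrite inv_diffE; try by move=> l; case: (aD l).
  by rewrite ler_wpM2r ?cabs_ge0//; case: (aD k).
(* Reassociating exposes [YLL^-1 H^T] as the single matrix [M]; the weights [d] are now [L|w|]. *)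
- rewrite /xiD -[_ *m invmx _ *m HC^T]mulmxA; apply: weighted_mulmx_le => //.
  + by move=> k; rewrite mxE -cabs_eq0 cabs_real normr_eq0 gt_eqF.
  + by rewrite divr_ge0 ?sqr_ge0.
  move=> k; rewrite inv_diffE; try by move=> l; case: (bD l).
  rewrite [toC _ _ _]mxE cabs_real (gtr0_norm (L0 k)).
  by rewrite ler_wpM2r ?cabs_ge0//; case: (bD k).
Qed.

(** * The two radii and the rate [q] *)

Section Radius.
Variables (vhat : 'cV[R[i]]_(3 * N)) (shat s : 'cV[R[i]]_(3 * N + 3 * N)).
Local Notation g := (gamma Y v0 vhat).
Local Notation r2 := (rho_ddagger Y v0 vhat shat).
Local Notation r1 := (rho_dagger Y v0 vhat shat s).
Hypothesis hshat : xi Y v0 shat < g ^+ 2.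
Hypothesis hs : xi Y v0 (s - shat) <
  4^-1 * ((g ^+ 2 - xi Y v0 shat) / g) ^+ 2.

Lemma gamma_gt0 : 0 < g.
Proof.
rewrite lt_def gamma_ge0 andbT -sqrf_eq0 gt_eqF//.
exact: le_lt_trans (xi_ge0 _) hshat.
Qed.

(** The factor 1/4 is the square of the 1/2 in [rho_ddagger]. The radicand in [rho_dagger] is thus
    positive. *)
Lemma xi_sub_lt : xi Y v0 (s - shat) < r2 ^+ 2.
Proof. by apply: lt_le_trans hs _; rewrite /rho_ddagger; lra. Qed.

Lemma rho_ddagger_gt0 : 0 < r2.
Proof. by rewrite mulr_gt0 ?invr_gt0// divr_gt0 ?gamma_gt0 ?subr_gt0. Qed.

Lemma rho_dagger_ge0 : 0 <= r1.
Proof.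
rewrite subr_ge0 -[leRHS](gtr0_norm rho_ddagger_gt0) -sqrtr_sqr.
by rewrite ler_wsqrtr// lerBlDr lerDl xi_ge0.
Qed.

Lemma rho_dagger_lt : r1 < r2.
Proof. by rewrite ltrBlDr ltrDl sqrtr_gt0 subr_gt0 xi_sub_lt. Qed.

(** Twice [rho_ddagger] is [gamma - xi shat / gamma], hence at most [gamma], and halving is strict
    because [gamma] is positive. *)
Lemma rho_ddagger_lt_gamma : r2 < g.
Proof.
have g0 := gamma_gt0; have xi0 := xi_ge0 shat.
suff : (g ^+ 2 - xi Y v0 shat) / g <= g by rewrite /rho_ddagger; lra.
by rewrite ler_pdivrMr// -expr2 lerBlDr lerDl.
Qed.

(** The cross term [2 * gamma * rho_ddagger] of the square is [gamma ^+ 2 - xi shat]. *)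
Lemma gamma_sub_rho_ddagger : (g - r2) ^+ 2 = xi Y v0 shat + r2 ^+ 2.
Proof.
rewrite /rho_ddagger; have /gt_eqF := gamma_gt0.
by move: g (xi Y v0 shat) => a b a0; field; rewrite a0.
Qed.

Lemma fpl_rate_lt1 : fpl_rate Y v0 vhat shat s < 1.
Proof.
have r12 := rho_dagger_lt; have r2g := rho_ddagger_lt_gamma.
have gr1 : 0 < g - r1 by lra.
(* As the smaller of [alpha] and [beta], [gamma] can replace both and give the two terms a common
   denominator. *)
have term_le c a : 0 <= c -> g <= a ->
    c / (a - r1) ^+ 2 <= c / (g - r1) ^+ 2.
  move=> c0 ga; rewrite ler_wpM2l// lef_pV2 ?posrE ?exprn_gt0//; last lra.
  by rewrite ler_sqr ?nnegrE; lra.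
apply: le_lt_trans (_ : xi Y v0 s / (g - r1) ^+ 2 < 1).
  rewrite /xi mulrDl; apply: lerD; apply: term_le.
  - exact: xiY_ge0.
  - by rewrite ge_min lexx.
  - exact: xiD_ge0.
  - by rewrite ge_min lexx orbT.
rewrite ltr_pdivrMr ?exprn_gt0// mul1r.
(* Split [s] as [shat + (s - shat)]; the value [(gamma - rho_ddagger) ^+ 2] lies strictly between
   the resulting sum and the target. *)
have := xi_addr shat (s - shat); rewrite addrC subrK => xis.
apply: le_lt_trans xis _; apply: lt_trans (_ : (g - r2) ^+ 2 < _).
  by rewrite gamma_sub_rho_ddagger ltrD2l xi_sub_lt.
by rewrite ltr_sqr ?nnegrE; lra.
Qed.

End Radius.

End LoadFlow.

Theorem theorem3 (R : realType) (N : nat) (hN : (1 <= N)%N)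
    (Y : 'M[R[i]]_(3 + 3 * N)) (v0 : 'cV[R[i]]_3)
    (hYLL : YLL Y \in unitmx)
    (hw : forall j, zero_load Y v0 j 0 != 0)
    (vhat : 'cV[R[i]]_(3 * N)) (shat : 'cV[R[i]]_(3 * N + 3 * N))
    (hvhat : load_flow Y v0 shat vhat)
    (hshat : xi Y v0 shat < gamma Y v0 vhat ^+ 2)
    (s : 'cV[R[i]]_(3 * N + 3 * N))
    (hs : xi Y v0 (s - shat) <
          4^-1 * ((gamma Y v0 vhat ^+ 2 - xi Y v0 shat)
                  / gamma Y v0 vhat) ^+ 2) :
  fpl_rate Y v0 vhat shat s < 1 /\
  forall v : 'cV[R[i]]_(3 * N),
    in_D Y v0 (rho_dagger Y v0 vhat shat s) vhat v ->
    load_flow Y v0 s v ->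
    vnorm_inf (fpl Y v0 vhat s - v)
      <= fpl_rate Y v0 vhat shat s * rho_dagger Y v0 vhat shat s
         * vnorm_inf (zero_load Y v0).
Proof.
split=> [|v vD vs]; first exact: fpl_rate_lt1.
have r0 := rho_dagger_ge0 s hshat.
(* Below [gamma], the radius keeps all entries of [v] and [H v] away from 0, so the fixed-point form
   applies to [v]. *)
have rg : rho_dagger Y v0 vhat shat s < gamma Y v0 vhat.
  by apply: lt_trans (rho_ddagger_lt_gamma hshat); apply: rho_dagger_lt.
have := rg; rewrite {1}/gamma lt_min => /andP[ra rb].
have vE : v = fpl Y v0 v s.
  apply: load_flow_fixed_point => // j.
    by case: (alpha_in_D r0 ra hw vD j).
  by case: (beta_in_D r0 rb vD j).
by rewrite {1}vE; apply: fpl_dist_le.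
Qed.
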